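(* Let $K\ge1$, let $D_X^K$ and $D_Y^K$ be two $K$-order dissimilarity networks on finite node sets $X$ and $Y$, and let $1\le k\le K$. Then for every $0\le k'<k$, $$ b^{k'}(D_X^K,D_Y^K)\le d^k_{\mathcal D}(D_X^K,D_Y^K),$$ where $b^{k'}$ is the bottleneck distance between the $k'$-th dimensional persistence diagrams of the induced filtrations $\mathcal L(D_X^K)$ and $\mathcal L(D_Y^K)$.
   Context: A $K$-order network on a finite set $X$ is a collection of functions $r_X^k:X^{k+1}\to[0,1]$, $0\le k\le K$, which are symmetric: $r_X^k(x_0,\dots,x_k)$ depends only on the set $\{x_0,\dots,x_k\}$ (not on order nor on repetitions). Write $x_{0:k}=(x_0,\dots,x_k)$. It is a dissimilarity network if for all $1\le k\le K$ and all $x_{0:k}$, $r_X^k(x_{0:k})\ge r_X^{k-1}(x_{0:k-1})$, with equality if and only if every element of $x_{0:k}$ already appears in $x_{0:k-1}$. A correspondence between $X$ and $Y$ is a set $C\subseteq X\times Y$ whose projections onto $X$ and onto $Y$ are surjective; $\mathcal C(X,Y)$ is the set of correspondences. For $0\le k\le K$ set $\Gamma^k_{X,Y}(C)=\max|r_X^k(x_{0:k})-r_Y^k(y_{0:k})|$ over all choices with $(x_i,y_i)\in C$ for $i=0,\dots,k$, and the $k$-order network distance $d^k_{\mathcal D}(D_X^K,D_Y^K)=\min_{C\in\mathcal C(X,Y)}\Gamma^k_{X,Y}(C)$. Induced filtration: for $\alpha\in[0,1]$, $L_\alpha$ is the simplicial complex of simplices $[x_{0:k}]$ (simplex on vertex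 set $\{x_0,\dots,x_k\}$), $0\le k\le K$, with $r_X^k(x_{0:k})\le\alpha$. The $j$-th dimensional persistence diagram is the multiset of points $(q_b,q_d)$, $q_b<q_d$, recording birth and death parameters of $j$-dimensional homology classes (over a fixed field) of $(L_\alpha)_\alpha$; classes never dying get death time $1$. Bottleneck distance: $c(\mathbf q,\tilde{\mathbf q})=\min\big[\max(|q_b-\tilde q_b|,|q_d-\tilde q_d|),\ \tfrac12\max(|q_d-q_b|,|\tilde q_d-\tilde q_b|)\big]$. For diagrams with point multisets $\mathcal Q,\tilde{\mathcal Q}$ of sizes $m\ge\tilde m$, augment $\tilde{\mathcal Q}$ by $m-\tilde m$ diagonal points $(t,t)$ to get $\tilde{\mathcal Q}_e$, and set $b^j=\min_\pi\max_{\mathbf q\in\mathcal Q}c(\mathbf q,\pi(\mathbf q))$ over bijections $\pi:\mathcal Q\to\tilde{\mathcal Q}_e$. *)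

(* Defs.v *)
From HB Require Import structures.
From mathcomp Require Import all_boot all_order all_algebra.
From mathcomp Require Import fingroup perm.
From mathcomp Require Import constructive_ereal.
Set Implicit Arguments. Unset Strict Implicit. Unset Printing Implicit Defensive.
Import Order.TTheory GRing.Theory Num.Theory.
Local Open Scope ring_scope.

(* A (higher-order) network on X: r k : X^{k+1} -> R, for every k
   (only k <= K is ever used). *)
Definition network (R : realFieldType) (X : finType) :=
  forall k : nat, k.+1.-tuple X -> R.

Definition is_dissim_network (R : realFieldType) (X : finType) (K : nat)
  (r : network R X) : Prop :=
  (forall k (t : k.+1.-tuple X), (k <= K)%N -> 0 <= r k t <= 1) /\
  (forall k (t t' : k.+1.-tuple X), (k <= K)%N ->
      [set x in t] = [set x in t'] -> r k t = r k t') /\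
  (forall k (t : k.+1.-tuple X) (x : X), (k.+1 <= K)%N ->
      r k t <= r k.+1 [tuple of rcons t x] /\
      (r k.+1 [tuple of rcons t x] = r k t <-> x \in t)).

Section Persistence.
Variables (R : realFieldType) (F : fieldType) (X : finType) (K : nat)
          (r : network R X).

Definition inL (a : R) (S : {set X}) : bool :=
  [exists k : 'I_K.+1, [exists t : k.+1.-tuple X,
     ([set x in t] == S) && (@r k t <= a)]].

Notation NS := #|{: {set X}}|.

(* simplicial boundary matrix (row-vector convention: chain u |-> u *m bdry),
   simplices oriented by the enumeration order of X; the empty face is
   excluded (non-reduced homology). *)
Definition bdry : 'M[F]_NS :=
  \matrix_(i, j)
    let s : {set X} := enum_val i in let t : {set X} := enum_val j in
    if [&& t \subset s, t != set0 & #|s :\: t| == 1%N]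
    then (-1) ^+ (\sum_(v in s :\: t)
                    #|[set u in s | (nat_of_ord (enum_rank u) < enum_rank v)%N]|)
    else 0.

Definition chainproj (a : R) (j : nat) : 'M[F]_NS :=
  diag_mx (\row_i ((inL a (enum_val i) && (#|(enum_val i : {set X})| == j.+1))%:R)).

Definition cycles (s : R) (j : nat) := (chainproj s j :&: kermx bdry)%MS.
Definition bounds (t : R) (j : nat) := (chainproj t j.+1 *m bdry)%MS.

(* persistent Betti number: rank of H_j(L_s) -> H_j(L_t) (s <= t) *)
Definition pbetti (j : nat) (s t : R) : nat :=
  (\rank (cycles s j) - \rank (cycles s j :&: bounds t j)%MS)%N.

Definition fvals : seq R :=
  flatten [seq [seq @r k t | t : k.+1.-tuple X] | k <- iota 0 K.+1].

(* largest filtration value strictly below p (or -1: L_{-1} is empty) *)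
Definition predv (p : R) : R := \big[Num.max/-1]_(v <- fvals | v < p) v.

(* multiplicity of the point (b,d) in the j-th persistence diagram
   (standard inclusion-exclusion of persistent Betti numbers; classes
   never dying are given death time 1) *)
Definition pmult (j : nat) (b d : R) : nat :=
  let b' := predv b in let d' := predv d in
  if d < 1 then ((pbetti j b d' + pbetti j b' d) - (pbetti j b' d' + pbetti j b d))%N
  else (pbetti j b d' - pbetti j b' d')%N.

Definition diagram (j : nat) : seq (R * R) :=
  let pts := [seq p <- [seq (b, d) | b <- undup fvals, d <- undup (1 :: fvals)]
             | p.1 < p.2] in
  flatten [seq nseq (pmult j p.1 p.2) p | p <- pts].

End Persistence.

Section Bottleneck.
Variable R : realFieldType.

Definition bcost (q q' : R * R) : R :=
  Num.min (Num.max `|q.1 - q'.1| `|q.2 - q'.2|)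
          (Num.max `|q.2 - q.1| `|q'.2 - q'.1| / 2).

Definition perm_cost (Q Q' : seq (R * R)) (s : 'S_(size Q)) : R :=
  \big[Num.max/0]_(i < size Q) bcost (nth (0, 0) Q i) (nth (0, 0) Q' (s i)).

Arguments perm_cost : clear implicits.
Definition bneck_eq (Q Q' : seq (R * R)) : R :=
  \big[Num.min/perm_cost Q Q' 1%g]_(s : 'S_(size Q)) perm_cost Q Q' s.

(* the smaller diagram is augmented with diagonal points (t,t); the cost of
   matching to a diagonal point does not depend on t, so t = 0 is used *)
Definition bottleneck (Q Q' : seq (R * R)) : R :=
  if (size Q' <= size Q)%N
  then bneck_eq Q (Q' ++ nseq (size Q - size Q') (0, 0))
  else bneck_eq Q' (Q ++ nseq (size Q' - size Q) (0, 0)).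

End Bottleneck.

Section NetDist.
Variables (R : realFieldType) (X Y : finType) (rX : network R X) (rY : network R Y).

Definition is_corr (C : {set X * Y}) : bool :=
  [forall x, exists y, (x, y) \in C] && [forall y, exists x, (x, y) \in C].

Definition Gamma (k : nat) (C : {set X * Y}) : R :=
  \big[Num.max/0]_(t : k.+1.-tuple (X * Y) | all (fun p => p \in C) t)
     `|@rX k (map_tuple fst t) - @rY k (map_tuple snd t)|.

Definition netdist (k : nat) : \bar R :=
  \big[Order.min/+oo%E]_(C : {set X * Y} | is_corr C) (Gamma k C)%:E.

End NetDist.

(* Main.v *)
(** Split a correspondence [C] into maps [f : X -> Y] and [g : Y -> X] with graphs
    in [C]. On the vertex set [V = X + Y], pull back the filtration of [X] along
    [(id, g)] and that of [Y] along [(f, id)]: since all pairs of images lie in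
    [C], the two filtrations of the simplex on [V] are [Gamma C]-interleaved by
    inclusion. The vertices outside [X] can be collapsed one at a time, so the
    pullback has the persistent Betti numbers of [X], and likewise for [Y].

    For one filtration, cycles [Z_s] and boundaries [B_t] are two flags of a
    single space, and the number of diagram points in the quadrant
    [{b <= s, d <= t}] is [dim (Z_s :&: B_t)]. Inside each graded piece of [B], a
    change of [Z] to an interleaved flag moves the sorted jumps by at most the
    interleaving parameter. Hence one may replace first [Z] and then [B], moving
    first only births and then only deaths; this matches the two diagrams. *)
Require Import Defs.
From HB Require Import structures.
From mathcomp Require Import all_boot all_order all_algebra.
From mathcomp Require Import fingroup perm.
From mathcomp Require Import constructive_ereal.
From mathcomp Require Import zify ring lra.
Import Order.TTheory GRing.Theory Num.Theory.
Local Open Scope ring_scope.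

Set Implicit Arguments.
Unset Strict Implicit.
Unset Printing Implicit Defensive.

(** * Quantiles of step functions *)

Section StepFunctions.
Variable R : realFieldType.
Implicit Types (G : seq R) (N : R -> nat) (s t p : R).

(** Right-continuous step functions with jumps only in [G]; the codomain is arbitrary so as to cover
    both dimensions and subspaces. *)
Definition step_on (T : Type) G (f : R -> T) : Prop :=
  forall s t, s <= t -> {in G, forall g, g <= t -> g <= s} -> f s = f t.

Definition pred_in G p : R := \big[Num.max/-1]_(v <- G | v < p) v.

Lemma pred_in_lt G p : -1 < p -> pred_in G p < p.
Proof.
move=> p0; rewrite /pred_in; apply: (big_ind (fun x => x < p)) => //.
by move=> x y xp yp; rewrite gt_max xp.
Qed.

Lemma le_pred_in G p v : v \in G -> v < p -> v <= pred_in G p.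
Proof. by move=> vG vp; rewrite /pred_in; apply: le_bigmax_seq. Qed.

Lemma pred_in_ge G p : -1 <= pred_in G p.
Proof. by rewrite /pred_in bigmax_ge_id. Qed.

Lemma floorP G s : {in G, forall g, s < g} \/
  exists2 g, g \in G & g <= s /\ {in G, forall v, v <= s -> v <= g}.
Proof.
elim: G => [|x G IH]; first by left.
have [xs|sx] := leP x s; last first.
  case: IH => [IH|[g gG [gs gmax]]].
    by left=> g; rewrite inE => /predU1P[->|/IH].
  right; exists g; first by rewrite inE gG orbT.
  split=> // v; rewrite inE => /predU1P[->|]; last exact: gmax.
  by rewrite leNgt sx.
right; case: IH => [IH|[g gG [gs gmax]]].
  exists x; first exact: mem_head.
  split=> // v; rewrite inE => /predU1P[->//|/IH]; by rewrite ltNge => /negPf->.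
exists (Num.max x g).
  by rewrite maxEle; case: ifP; rewrite !inE ?eqxx ?gG ?orbT.
split=> [|v]; first by rewrite ge_max xs.
by rewrite inE le_max => /predU1P[->|/gmax H /H ->]; rewrite ?lexx ?orbT.
Qed.

Lemma step_eq0 G N s : step_on G N -> {homo N : s t / s <= t >-> (s <= t)%N} ->
  N (-1) = 0%N -> {in G, forall g, s < g} -> N s = 0%N.
Proof.
move=> Nst Nm N0 Gs; case: (leP s (-1)) => [/Nm|/ltW s1].
  by rewrite N0 leqn0 => /eqP.
by rewrite -N0; apply/esym/Nst => // g /Gs; rewrite ltNge => /negPf->.
Qed.

(** Strong induction on the number of grid points up to [t]: the largest contributes the last
    increment, and the others are those up to its predecessor. *)
Lemma telescope_steps G N t : uniq G -> {in G, forall g, -1 < g} ->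
  step_on G N -> {homo N : s t / s <= t >-> (s <= t)%N} -> N (-1) = 0%N ->
  (\sum_(g <- G | (g <= t)%R) (N g - N (pred_in G g)) = N t)%N.
Proof.
move=> Gu G0 Nst Nm N0.
have [n] := ubnP (count (<= t) G); elim: n t => // n IH t ct.
case: (floorP G t) => [Gt|[g gG [gt gmax]]].
  rewrite (step_eq0 Nst Nm N0 Gt) big_seq_cond big_pred0 // => g.
  by apply/andP=> -[/Gt]; rewrite ltNge => /negP.
have <- : N g = N t by apply: Nst.
have pg : pred_in G g < g by apply/pred_in_lt/G0.
have eqG v : v \in G -> (v <= t) && (v != g) = (v <= pred_in G g).
  move=> vG; apply/andP/idP => [[vt vg]|vp].
    by apply: le_pred_in => //; rewrite lt_neqAle vg gmax.
  by split; [apply: le_trans vp (le_trans (ltW pg) gt)|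
             rewrite lt_eqF // (le_lt_trans vp)].
have splitG (f : R -> nat) : (\sum_(v <- G | (v <= t)%R) f v =
    f g + \sum_(v <- G | (v <= pred_in G g)%R) f v)%N.
  rewrite -big_filter (bigD1_seq g) ?filter_uniq //= ?mem_filter ?gt //.
  rewrite big_filter_cond big_seq_cond [in RHS]big_seq_cond.
  congr (_ + _)%N; apply: eq_bigl => v.
  by case vG: (v \in G) => //=; rewrite eqG.
rewrite splitG IH ?subnK ?Nm ?ltW //.
by move: ct; rewrite -!sum1_count splitG.
Qed.

(** Generalised inverse of [N]: the position of jump number [m], counted from 0 with multiplicity.
    The default 1 is itself admissible when [m < N 1]. *)
Definition quantile G N m : R := \big[Num.min/1]_(g <- G | (m < N g)%N) g.

(** A Galois connection: comparisons of quantiles become comparisons of values of [N]. *)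
Lemma quantileP G N m s : step_on G N ->
  {homo N : s t / s <= t >-> (s <= t)%N} -> N (-1) = 0%N -> (m < N 1%R)%N ->
  (quantile G N m <= s) = (m < N s)%N.
Proof.
move=> Nst Nm N0 m1; apply/idP/idP => [|ms].
  move/Nm; apply: leq_trans; rewrite /quantile.
  by apply: (big_ind (fun x => (m < N x)%N)) => // x y xp yp; rewrite minEle; case: ifP.
case: (floorP G s) => [Gt|[g gG [gs gmax]]].
  by rewrite (step_eq0 Nst Nm N0 Gt) in ms.
apply: le_trans (gs); apply: bigmin_inf_seq gG _ (lexx _).
by rewrite (Nst g s gs gmax).
Qed.

Lemma quantile_in G N m : 1 \in G -> quantile G N m \in G.
Proof.
move=> G1; rewrite /quantile big_seq_cond.
apply: (big_ind (fun x => x \in G)) => [//|x y|x /andP[]//].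
by rewrite minEle; case: ifP.
Qed.

Lemma count_quantile G N s : step_on G N ->
  {homo N : s t / s <= t >-> (s <= t)%N} -> N (-1) = 0%N -> (N s <= N 1%R)%N ->
  count (<= s) [seq quantile G N m | m <- iota 0 (N 1)] = N s.
Proof.
move=> Nst Nm N0 Ns; rewrite count_map.
rewrite (eq_in_count (a2 := fun m => (m < N s)%N)) => [|m]; last first.
  by rewrite mem_iota => /andP[_ m1] /=; rewrite quantileP.
rewrite -(subnKC Ns) iotaD count_cat add0n.
rewrite (eq_in_count (a2 := predT)) => [|m]; last by rewrite mem_iota add0n.
rewrite count_predT size_iota (eq_in_count (a2 := pred0)) ?count_pred0 ?addn0 //.
by move=> m; rewrite mem_iota /= => /andP[+ _]; rewrite ltnNge => ->.
Qed.

End StepFunctions.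

(** * Multisets of points: quadrant counts and matchings *)

Section Points.
Variable R : realFieldType.
Implicit Types (G : seq R) (P Q : seq (R * R)) (p : R * R).

Definition quadrant (s t : R) : pred (R * R) := fun p => (p.1 <= s) && (p.2 <= t).

(** Inclusion-exclusion over the quadrants cornered at [(b, d)] and its predecessors, written with
    sums only because subtraction on [nat] truncates. *)
Lemma count_mem_quadrant G G' P b d :
  {in G, forall g, -1 < g} -> {in G', forall g, -1 < g} ->
  {in P, forall p, p.1 \in G /\ p.2 \in G'} -> b \in G -> d \in G' ->
  (count_mem (b, d) P + count (quadrant (pred_in G b) d) P
     + count (quadrant b (pred_in G' d)) P
   = count (quadrant b d) P + count (quadrant (pred_in G b) (pred_in G' d)) P)%N.
Proof.
move=> G0 G'0 + bG dG; elim: P => //= -[x y] P IH H.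
have {}IH := IH (fun p pP => H p (@mem_behead _ ((x, y) :: P) p pP)).
have [/= xG yG] := H (x, y) (mem_head _ _).
have key (K : seq R) u v : {in K, forall g, -1 < g} -> u \in K -> v \in K ->
    (v <= pred_in K u) = (v < u).
  move=> K0 uK vK; apply/idP/idP; last exact: le_pred_in.
  by move=> H1; apply: le_lt_trans H1 _; apply/pred_in_lt/K0.
rewrite /quadrant /= !key // xpair_eqE; move: IH; rewrite /quadrant.
by case: (ltgtP x b) => _; case: (ltgtP y d) => _ /=; lia.
Qed.

Lemma perm_quadrant G G' P Q :
  {in G, forall g, -1 < g} -> {in G', forall g, -1 < g} ->
  {in P, forall p, p.1 \in G /\ p.2 \in G'} ->
  {in Q, forall p, p.1 \in G /\ p.2 \in G'} ->
  (forall s t, count (quadrant s t) P = count (quadrant s t) Q) -> perm_eq P Q.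
Proof.
move=> G0 G'0 HP HQ H; apply/allP => -[b d]; rewrite mem_cat => bd /=.
have [bG dG] : b \in G /\ d \in G' by case/orP: bd => [/HP|/HQ].
have := count_mem_quadrant G0 G'0 HP bG dG.
have := count_mem_quadrant G0 G'0 HQ bG dG.
rewrite !H => <- /eqP; by rewrite !eqn_add2r.
Qed.

Lemma count_mem_nseqs (T : eqType) (m : T -> nat) (s : seq T) x : uniq s ->
  count_mem x (flatten [seq nseq (m y) y | y <- s]) = ((x \in s) * m x)%N.
Proof.
elim: s => //= y s IH /andP[ys us]; rewrite count_cat count_nseq IH //= inE eq_sym.
by case: eqVneq => [->|]; rewrite ?(negPf ys) /= ?mul0n ?mul1n ?addn0.
Qed.

Definition matched (r : R * R -> R * R -> bool) P Q : Prop :=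
  exists I : seq ((R * R) * (R * R)),
    [/\ perm_eq P (unzip1 I), perm_eq Q (unzip2 I) & all (fun i => r i.1 i.2) I].

(** Reorders a matching so that its left components follow a given list; two matchings then compose
    by zipping. *)
Lemma perm_unzip (T : eqType) (I : seq (T * T)) (s : seq T) : perm_eq s (unzip1 I) ->
  exists2 J, perm_eq J I & unzip1 J = s.
Proof.
elim: s I => [|x s IH] I.
  by case: I => [|i I]; [exists [::] | rewrite perm_sym => /perm_nilP].
move=> xsI; have /mapP[i iI xi] : x \in unzip1 I by rewrite -(perm_mem xsI) mem_head.
have IE := perm_to_rem iI.
have [|J JI Js] := IH (rem i I).
  have := perm_map fst IE => /= H; move: (perm_trans xsI H).
  by rewrite xi perm_cons.
exists (i :: J); last by rewrite /= Js xi.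
by rewrite perm_sym (perm_trans IE) // perm_cons perm_sym.
Qed.

Lemma matched_trans (r1 r2 r3 : R * R -> R * R -> bool) P Q S :
  (forall p q s, r1 p q -> r2 q s -> r3 p s) ->
  matched r1 P Q -> matched r2 Q S -> matched r3 P S.
Proof.
move=> r123 [I [PI QI rI]] [J [QJ SJ rJ]].
have [|J' J'J J'I] := @perm_unzip _ J (unzip2 I).
  by apply: perm_trans QJ; rewrite perm_sym.
have sIJ : size I = size J' by have := congr1 size J'I; rewrite !size_map.
have rJ' : all (fun i => r2 i.1 i.2) J' by rewrite (perm_all _ J'J).
exists (zip (unzip1 I) (unzip2 J')); rewrite unzip1_zip ?unzip2_zip ?size_map ?sIJ //.
split=> //.
  by apply: perm_trans SJ _; apply: perm_map; rewrite perm_sym.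
elim: I J' J'I rI rJ' sIJ {J'J PI QI} => [|[p q] I IH] [|[q' s] J'] //= [-> eJ].
by move=> /andP[h1 hI] /andP[h2 hJ] [e]; rewrite (r123 _ _ _ h1 h2) IH.
Qed.

Lemma matched_map (T : eqType) (f g : T -> R * R) (r : R * R -> R * R -> bool) s :
  {in s, forall x, r (f x) (g x)} -> matched r [seq f x | x <- s] [seq g x | x <- s].
Proof.
move=> H; exists [seq (f x, g x) | x <- s]; rewrite /unzip1 /unzip2 -!map_comp.
by split=> //; rewrite all_map; apply/allP => x /H.
Qed.

Lemma matched_perm r P P' Q Q' : perm_eq P' P -> perm_eq Q' Q ->
  matched r P Q -> matched r P' Q'.
Proof.
move=> PP QQ [I [PI QI rI]]; exists I.
by split=> //; [apply: perm_trans PP PI | apply: perm_trans QQ QI].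
Qed.

Lemma matched_swap (r r' : R * R -> R * R -> bool) (h : R * R -> R * R) P Q :
  (forall p q, r p q -> r' (h p) (h q)) ->
  matched r P Q -> matched r' [seq h p | p <- P] [seq h q | q <- Q].
Proof.
move=> rr [I [PI QI rI]]; exists [seq (h i.1, h i.2) | i <- I].
split.
- by rewrite /unzip1 -map_comp (_ : map _ I = map h (unzip1 I)) ?perm_map // -map_comp.
- by rewrite /unzip2 -map_comp (_ : map _ I = map h (unzip2 I)) ?perm_map // -map_comp.
by rewrite all_map; apply: sub_all rI => i /=; apply: rr.
Qed.

End Points.
(** * Pairs of flags *)

Section Subspaces.
Variable F : fieldType.

(* [(U :&: P) / (U :&: P')] embeds into [(U' :&: P) / (U' :&: P')]. *)
Lemma rank_cap_leq m1 m2 m3 m4 n (U : 'M[F]_(m1, n)) (U' : 'M[F]_(m2, n))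
    (P : 'M[F]_(m3, n)) (P' : 'M[F]_(m4, n)) :
  (U <= U')%MS -> (P' <= P)%MS ->
  (\rank (U :&: P) + \rank (U' :&: P') <= \rank (U' :&: P) + \rank (U :&: P'))%N.
Proof.
move=> UU PP; rewrite -mxrank_sum_cap leq_add //.
  by apply: mxrankS; rewrite addsmx_sub !capmxS.
apply: mxrankS; rewrite sub_capmx.
have h := capmxSr (U :&: P)%MS (U' :&: P')%MS.
rewrite (submx_trans (capmxSl _ _) (capmxSl _ _)).
by rewrite (submx_trans h (capmxSr _ _)).
Qed.

(** Modulo [B'], the map [I] sends [Z] into the image of [Z'] with kernel inside [Z :&: B];
    rank-nullity concludes. *)
Lemma rank_quo_leq n1 n2 (I : 'M[F]_(n1, n2)) (Z B : 'M[F]_n1) (Z' B' : 'M[F]_n2) :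
  (Z *m I <= Z')%MS ->
  (forall u : 'rV_n1, (u <= Z)%MS -> (u *m I <= B')%MS -> (u <= B)%MS) ->
  (\rank Z - \rank (Z :&: B) <= \rank Z' - \rank (Z' :&: B'))%N.
Proof.
move=> ZI IB; have := mxrank_mul_ker Z (I *m cokermx B').
have := mxrank_mul_ker Z' (cokermx B').
have -> : \rank (Z' :&: kermx (cokermx B')) = \rank (Z' :&: B').
  apply/eqP; rewrite eqn_leq !mxrankS // capmxS //.
    by rewrite sub_kermx mulmx_coker.
  by rewrite submxE mulmx_ker.
have h1 : (\rank (Z *m (I *m cokermx B')) <= \rank (Z' *m cokermx B'))%N.
  by rewrite mulmxA; apply/mxrankS/submxMr.
have h2 : (\rank (Z :&: kermx (I *m cokermx B')) <= \rank (Z :&: B))%N.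
  apply: mxrankS; rewrite sub_capmx capmxSl; apply/row_subP => i.
  have := row_sub i (Z :&: kermx (I *m cokermx B'))%MS.
  rewrite sub_capmx => /andP[uZ /sub_kermxP uI]; apply: IB => //.
  by rewrite submxE -mulmxA uI.
lia.
Qed.

End Subspaces.

Section Flags.
Variables (R : realFieldType) (F : fieldType) (n : nat).
Implicit Types (G : seq R) (Z B : R -> 'M[F]_n).

(** Filling the space from 1 on gives all flags the same total dimension, so that their points can
    be matched without leftovers. *)
Record flag G Z : Prop := Flag {
  flag_uniq : uniq G;
  flag_gt : {in G, forall g, -1 < g};
  flag_in1 : 1 \in G;
  flag_step : step_on G Z;
  flag_mono : forall s t, s <= t -> (Z s <= Z t)%MS;
  flag_bot : Z (-1) = 0;
  flag_top : forall s, 1 <= s -> Z s = 1%:M }.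

Definition capdim Z B s t : nat := \rank (Z s :&: B t)%MS.

Lemma capdimC Z B s t : capdim Z B s t = capdim B Z t s.
Proof. by rewrite /capdim capmxC. Qed.

(** Dimension of the trace of [Z s] on the graded piece [B d / B d']. *)
Definition column Z B (d' d s : R) : nat := (capdim Z B s d - capdim Z B s d')%N.

(* The bidegrees of a basis of the ambient space adapted to both flags. *)
Definition points GZ Z GB B : seq (R * R) :=
  [seq (quantile GZ (column Z B (pred_in GB d) d) m, d)
  | d <- GB, m <- iota 0 (\rank (B d) - \rank (B (pred_in GB d)))].

Section Column.
Variables (GZ GB : seq R) (Z B : R -> 'M[F]_n).
Hypotheses (fZ : flag GZ Z) (fB : flag GB B).

Lemma capdim_mono s s' t t' : s <= s' -> t <= t' ->
  (capdim Z B s t <= capdim Z B s' t')%N.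
Proof.
by move=> ss tt; apply/mxrankS/capmxS; [apply: (flag_mono fZ)|apply: (flag_mono fB)].
Qed.

Lemma column_le d' d s Z' s' : d' <= d -> (Z s <= Z' s')%MS ->
  (column Z B d' d s <= column Z' B d' d s')%N.
Proof.
move=> dd ZZ; have := rank_cap_leq ZZ (flag_mono fB dd); rewrite /column /capdim.
have := mxrankS (capmxS (submx_refl (Z s)) (flag_mono fB dd)).
have := mxrankS (capmxS (submx_refl (Z' s')) (flag_mono fB dd)).
lia.
Qed.

Lemma column_mono d' d : d' <= d ->
  {homo column Z B d' d : s t / s <= t >-> (s <= t)%N}.
Proof. by move=> dd s t st; apply: column_le => //; apply: (flag_mono fZ). Qed.

Lemma column_step d' d : step_on GZ (column Z B d' d).
Proof. by move=> s t st h; rewrite /column /capdim (flag_step fZ st h). Qed.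

Lemma column_bot d' d : column Z B d' d (-1) = 0%N.
Proof. by rewrite /column /capdim (flag_bot fZ) !cap0mx !mxrank0. Qed.

Lemma column_top d' d : column Z B d' d 1 = (\rank (B d) - \rank (B d'))%N.
Proof. by rewrite /column /capdim (flag_top fZ) // !cap1mx. Qed.

Lemma column_bound d' d s : d' <= d -> (column Z B d' d s <= column Z B d' d 1)%N.
Proof. by move=> dd; apply: column_le => //; rewrite (flag_top fZ (lexx _)) submx1. Qed.

Lemma capdim_bot s : capdim Z B s (-1) = 0%N.
Proof. by rewrite /capdim (flag_bot fB) capmx0 mxrank0. Qed.

Lemma pred_in_ltG d : d \in GB -> pred_in GB d < d.
Proof. by move=> dG; apply/pred_in_lt/(flag_gt fB). Qed.

(** In the column of height [d], the quantiles up to [s] number the increment of [capdim Z B s] at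
    [d]; these increments telescope over [d]. *)
Lemma count_points s t : count (quadrant s t) (points GZ Z GB B) = capdim Z B s t.
Proof.
rewrite /points count_flatten -map_comp sumnE big_map.
rewrite -(telescope_steps (N := capdim Z B s) t (flag_uniq fB) (flag_gt fB)).
- rewrite [RHS]big_mkcond big_seq [RHS]big_seq; apply: eq_bigr => d dG /=.
  have pd := ltW (pred_in_ltG dG).
  rewrite count_map /quadrant /=; case: ifP => dt; last first.
    by rewrite (eq_count (a2 := pred0)) ?count_pred0 // => m; rewrite /= dt andbF.
  have := count_quantile (column_step _ _) (column_mono pd) (column_bot _ _)
     (column_bound s pd).
  rewrite column_top count_map => H; rewrite -[RHS]/(column Z B _ _ s) -[in RHS]H.
  by apply: eq_count => m; rewrite /= dt andbT.
- by move=> x y xy h; rewrite /capdim (flag_step fB xy h).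
- by move=> x y xy; apply: capdim_mono.
- exact: capdim_bot.
Qed.

Lemma points_in p : p \in points GZ Z GB B -> p.1 \in GZ /\ p.2 \in GB.
Proof.
case/allpairsPdep=> d [m [dG _ ->]]; split=> //=.
by apply/quantile_in/(flag_in1 fZ).
Qed.

End Column.

Definition near (e : R) (p q : R * R) : bool := (`|p.1 - q.1| <= e) && (`|p.2 - q.2| <= e).
Definition near1 (e : R) (p q : R * R) : bool := (`|p.1 - q.1| <= e) && (p.2 == q.2).
Definition near2 (e : R) (p q : R * R) : bool := (p.1 == q.1) && (`|p.2 - q.2| <= e).

Definition interleaved (e : R) (Z Z' : R -> 'M[F]_n) : Prop :=
  forall s, (Z s <= Z' (s + e)%R)%MS /\ (Z' s <= Z (s + e)%R)%MS.

(* Both lists enumerate the column of height [d] by the same index [m], so that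
   only the two quantile functions have to be compared. *)
Lemma points_move GZ Z GZ' (Z' : R -> 'M[F]_n) GB B e : flag GZ Z -> flag GZ' Z' -> flag GB B ->
  interleaved e Z Z' ->
  matched (near1 e) (points GZ Z GB B) (points GZ' Z' GB B).
Proof.
move=> fZ fZ' fB ZZ.
pose idx := [seq (d, m) | d <- GB, m <- iota 0 (\rank (B d) - \rank (B (pred_in GB d)))].
have E K Y : points K Y GB B =
    [seq (quantile K (column Y B (pred_in GB i.1) i.1) i.2, i.1) | i <- idx].
  by rewrite map_allpairs.
rewrite !E; apply: matched_map => i /allpairsPdep [d [m [dG]]].
rewrite mem_iota add0n => /andP[_ md] -> /=; rewrite /near1 eqxx andbT /=.
have pd := ltW (pred_in_ltG fB dG).
(* By the Galois connection this reduces to [column_le] at parameters [e] apart. *)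
have le K K' Y Y' : flag K Y -> flag K' Y' -> (forall s, (Y s <= Y' (s + e)%R)%MS) ->
    quantile K' (column Y' B (pred_in GB d) d) m <=
    quantile K (column Y B (pred_in GB d) d) m + e.
  move=> fY fY' YY.
  rewrite (quantileP _ (column_step _ fY' _ _) (column_mono fY' fB pd) (column_bot _ fY' _ _));
    last by rewrite (column_top _ fY').
  apply: leq_trans (column_le fB pd (YY _)).
  rewrite -(quantileP _ (column_step _ fY _ _) (column_mono fY fB pd) (column_bot _ fY _ _)) //.
  by rewrite (column_top _ fY).
have := le _ _ _ _ fZ fZ' (fun s => proj1 (ZZ s)).
have := le _ _ _ _ fZ' fZ (fun s => proj2 (ZZ s)).
by rewrite ler_norml; lra.
Qed.

Definition swap (p : R * R) : R * R := (p.2, p.1).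

(** Quadrant counts are dimensions of intersections, hence symmetric in the two flags. *)
Lemma perm_points_swap GZ Z GB B : flag GZ Z -> flag GB B ->
  perm_eq (points GZ Z GB B) [seq swap p | p <- points GB B GZ Z].
Proof.
move=> fZ fB; apply: (perm_quadrant (flag_gt fZ) (flag_gt fB)).
- exact: points_in.
- by move=> _ /mapP[p /(points_in fB) [p1 p2] ->].
move=> s t; rewrite count_map (count_points fZ fB) capdimC -(count_points fB fZ).
by apply: eq_count => p; rewrite /quadrant /= andbC.
Qed.

(* The two flags can be moved one after the other because the cost of a match is
   a maximum over the coordinates. *)
Lemma points_stable GZ Z GB B GZ' (Z' : R -> 'M[F]_n) GB' (B' : R -> 'M[F]_n) e :
  flag GZ Z -> flag GB B -> flag GZ' Z' -> flag GB' B' ->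
  interleaved e Z Z' -> interleaved e B B' ->
  matched (near e) (points GZ Z GB B) (points GZ' Z' GB' B').
Proof.
move=> fZ fB fZ' fB' ZZ BB.
apply: (matched_trans _ (points_move fZ fZ' fB ZZ) (r2 := near2 e)).
  move=> p q s /andP[h1 /eqP h2] /andP[/eqP h3 h4].
  by rewrite /near h2 -h3 h1.
apply: matched_perm (perm_points_swap fZ' fB) (perm_points_swap fZ' fB') _.
apply: matched_swap (points_move fB fB' fZ' BB) => p q /andP[h1 h2].
by rewrite /near2 /= h2.
Qed.

End Flags.
(** * Simplicial chains and vertex collapses *)

Section Chains.
Variable F : fieldType.

Local Notation dim V := #|{: {set V}}|.

Section Monomial.
Variables V W : finType.

Definition simplex (S : {set V}) : 'rV[F]_(dim V) := delta_mx 0 (enum_rank S).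

Definition monomial (a : {set V} -> F) (f : {set V} -> {set W}) :
    'M[F]_(dim V, dim W) :=
  \matrix_(i, j) (a (enum_val i) *+ (f (enum_val i) == enum_val j)).

(** A projector rather than a basis: its row space is the chain space, and multiplication by it
    restricts a chain to [P]. *)
Definition chains (P : pred {set V}) : 'M[F]_(dim V) :=
  diag_mx (\row_i (P (enum_val i))%:R).

End Monomial.

Lemma simplex_monomial (V W : finType) a (f : {set V} -> {set W}) S :
  simplex S *m monomial a f = a S *: simplex (f S).
Proof.
rewrite -rowE; apply/rowP => j; rewrite !mxE enum_rankK eqxx /=.
by rewrite -(can_eq enum_valK) enum_rankK eq_sym mulr_natr.
Qed.

Lemma simplex_ext (V : finType) n (A B : 'M[F]_(dim V, n)) :
  (forall S, simplex S *m A = simplex S *m B) -> A = B.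
Proof.
move=> AB; apply/row_matrixP => i.
by have := AB (enum_val i); rewrite /simplex enum_valK -!rowE.
Qed.

Section OneSet.
Variable V : finType.
Implicit Types (P Q : pred {set V}) (S : {set V}).

Lemma simplex_chains P S : simplex S *m chains P = (P S)%:R *: simplex S.
Proof.
rewrite /chains -rowE row_diag_mx; congr (_ *: _).
by rewrite mxE enum_rankK.
Qed.

Lemma simplex_in P S : P S -> (simplex S <= chains P)%MS.
Proof. by move=> PS; apply/submxP; exists (simplex S); rewrite simplex_chains PS scale1r. Qed.

Lemma chains_id P m (u : 'M_(m, dim V)) : (u <= chains P)%MS -> u *m chains P = u.
Proof.
case/submxP => D ->; rewrite -mulmxA; congr (_ *m _).
apply: simplex_ext => S; rewrite mulmxA !simplex_chains -scalemxAl simplex_chains.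
by case: (P S); rewrite ?scale1r ?scale0r.
Qed.

Lemma chains_mulP P n m (M : 'M[F]_(dim V, n)) (E : 'M[F]_(m, n)) :
  (forall S, P S -> (simplex S *m M <= E)%MS) -> (chains P *m M <= E)%MS.
Proof.
move=> PM; apply/row_subP => i; rewrite rowE -[i]enum_valK mulmxA.
rewrite -/(simplex _) simplex_chains -scalemxAl.
case: (boolP (P _)) => [/PM h|_]; first by rewrite scale1r.
by rewrite scale0r sub0mx.
Qed.

Lemma chains_mul_sub P n m k (M : 'M[F]_(dim V, n)) (E : 'M[F]_(m, n)) (u : 'M_(k, _)) :
  (forall S, P S -> (simplex S *m M <= E)%MS) -> (u <= chains P)%MS -> (u *m M <= E)%MS.
Proof. by move=> PM uP; apply: submx_trans (chains_mulP PM); apply: submxMr. Qed.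

Lemma chains_sub P Q : (forall S, P S -> Q S) -> (chains P <= chains Q)%MS.
Proof.
by move=> PQ; rewrite -[chains P]mulmx1; apply: chains_mulP => S /PQ;
  rewrite mulmx1; apply: simplex_in.
Qed.

Lemma eq_chains P Q : P =1 Q -> chains P = chains Q.
Proof. by move=> PQ; congr diag_mx; apply/rowP => i; rewrite !mxE PQ. Qed.

End OneSet.

(* Chains are the exterior algebra on the vertices, ordered by [rk]: [ins v] is
   left multiplication by [v], [del v] is the contraction by its dual. Row
   vectors are acted on from the right, so products are read left to right. *)
Section Operators.
Variables (V : finType) (rk : V -> nat).
Hypothesis rk_inj : injective rk.
Implicit Types (S : {set V}) (u v w : V).

Definition sgn v S : F := (-1) ^+ #|[set u in S | (rk u < rk v)%N]|.

Definition ins v := monomial (fun S => if v \in S then 0 else sgn v S) (fun S => v |: S).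
Definition del v := monomial (fun S => if v \in S then sgn v S else 0) (fun S => S :\ v).

(** The augmented boundary, for which the operator identities have no exceptional case; [boundary]
    then discards the empty face. *)
Definition full_boundary : 'M[F]_(dim V) := \sum_v del v.

Definition boundary : 'M[F]_(dim V) := full_boundary *m chains [pred S | S != set0].

Lemma simplex_ins v S :
  simplex S *m ins v = (if v \in S then 0 else sgn v S) *: simplex (v |: S).
Proof. exact: simplex_monomial. Qed.

Lemma simplex_del v S :
  simplex S *m del v = (if v \in S then sgn v S else 0) *: simplex (S :\ v).
Proof. exact: simplex_monomial. Qed.

Lemma sgnK v S : sgn v S * sgn v S = 1.
Proof. by rewrite -expr2 sqrr_sign. Qed.

Lemma sgn_setU1 u v S : u \notin S ->
  sgn v (u |: S) = (-1) ^+ (rk u < rk v)%N * sgn v S.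
Proof.
move=> uS; rewrite /sgn -exprD; congr (_ ^+ _).
case: ltnP => uv; last first.
  rewrite add0n; apply: eq_card => x; rewrite !inE.
  by case: eqVneq => //= ->; rewrite (negPf uS) ltnNge uv.
rewrite (cardsD1 u) !inE eqxx uv; congr (_ + _)%N; apply: eq_card => x.
by rewrite !inE; case: eqVneq => //= ->; rewrite (negPf uS).
Qed.

Lemma sgn_setD1 u v S : u \in S ->
  sgn v (S :\ u) = (-1) ^+ (rk u < rk v)%N * sgn v S.
Proof.
move=> uS; rewrite -{2}(setD1K uS) sgn_setU1 ?setD11 //.
by rewrite mulrA -expr2 sqrr_sign mul1r.
Qed.

Lemma sign_ltC u v : u != v ->
  (-1) ^+ (rk u < rk v)%N = - (-1) ^+ (rk v < rk u)%N :> F.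
Proof.
by move=> uv; case: ltngtP => [_|_|/rk_inj/eqP]; rewrite ?expr1 ?expr0 ?opprK // (negPf uv).
Qed.

(** Canonical anticommutation relation. For [u != v] the signs are opposite because exactly one of
    the two vertices precedes the other. *)
Lemma ins_del v u : ins v *m del u + del u *m ins v = (u == v)%:R%:M.
Proof.
apply: simplex_ext => S; rewrite mulmxDr !mulmxA simplex_ins simplex_del -!scalemxAl.
rewrite simplex_ins simplex_del mul_mx_scalar !scalerA !inE.
case: (eqVneq u v) => [->|uv] /=.
  rewrite ?eqxx /=; case: ifP => vS; rewrite ?(mul0r, scale0r, addr0, add0r, mulr0).
    by rewrite sgn_setD1 // ltnn mul1r sgnK setD1K.
  by rewrite sgn_setU1 ?vS // ltnn mul1r sgnK setU1K // vS.
rewrite ?(negPf uv) /=.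
case: ifP => vS; case: ifP => uS; rewrite ?(mul0r, mulr0, scale0r, addr0, add0r) //.
rewrite sgn_setU1 ?vS // sgn_setD1 // (sign_ltC uv).
have -> : v |: S :\ u = (v |: S) :\ u.
  by apply/setP => x; rewrite !inE; case: (eqVneq x v) => //= ->; rewrite eq_sym uv.
by rewrite -scalerDl [X in X *: _](_ : _ = 0) ?scale0r //; ring.
Qed.

Lemma del_del v u : del v *m del u + del u *m del v = 0.
Proof.
apply: simplex_ext => S; rewrite mulmxDr !mulmxA !simplex_del -!scalemxAl.
rewrite !simplex_del !scalerA !inE mulmx0.
case: (eqVneq u v) => [->|uv] /=; first by rewrite ?eqxx /= mulr0 !scale0r addr0.
rewrite ?(negPf uv) /=.
case: ifP => vS; case: ifP => uS; rewrite ?(mul0r, mulr0, scale0r, addr0, add0r) //.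
rewrite !sgn_setD1 // (sign_ltC uv) !setDDl (setUC [set u]).
by rewrite -scalerDl [X in X *: _](_ : _ = 0) ?scale0r //; ring.
Qed.

(** Sum of the anticommutation relations over all [u]: the cone with apex [v] contracts the
    augmented full simplex. *)
Lemma ins_boundary v : ins v *m full_boundary = 1%:M - full_boundary *m ins v.
Proof.
apply/eqP; rewrite eq_sym subr_eq eq_sym; apply/eqP.
rewrite /full_boundary mulmx_sumr mulmx_suml -big_split /=.
rewrite (bigD1 v) //= ins_del eqxx big1 ?addr0 // => u uv.
by rewrite ins_del (negPf uv) raddf0.
Qed.

Lemma del_boundary w : del w *m full_boundary = - (full_boundary *m del w).
Proof.
apply/eqP; rewrite -addr_eq0 /full_boundary mulmx_sumr mulmx_suml -big_split /=.
by rewrite big1 // => u _; rewrite del_del.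
Qed.

Section Collapse.
Variables v w : V.
Hypothesis vw : v != w.

(* The algebra morphism sending [w] to [v] and fixing the other vertices, and
   its homotopy to the identity. *)
Definition collapse : 'M[F]_(dim V) := 1%:M - del w *m (ins w - ins v).
Definition prism : 'M[F]_(dim V) := del w *m ins w *m ins v.

Lemma collapse_boundary : collapse *m full_boundary = full_boundary *m collapse.
Proof.
(* The identity terms cancel in the difference, which therefore anticommutes with the boundary, as
   [del w] does; so their product commutes with it. *)
have insB : (ins w - ins v) *m full_boundary = - (full_boundary *m (ins w - ins v)).
  by rewrite mulmxBl mulmxBr !ins_boundary !opprB addrC addrA subrK.
rewrite /collapse; move: (ins w - ins v) insB => d insB.
rewrite mulmxBl mulmxBr mul1mx mulmx1; congr (_ - _).
by rewrite -mulmxA insB mulmxN !mulmxA del_boundary mulNmx opprK.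
Qed.

(** Moving the boundary leftwards through the factors of [prism] leaves
    [del w *m (ins w - ins v)]. *)
Lemma prism_boundary :
  prism *m full_boundary + full_boundary *m prism = 1%:M - collapse.
Proof.
have delins : del w *m ins w *m full_boundary *m ins v =
    del w *m ins v + full_boundary *m prism.
  rewrite -(mulmxA (del w)) ins_boundary mulmxBr mulmx1 mulmxBl !mulmxA.
  by rewrite del_boundary !mulNmx opprK.
rewrite {1}/prism -mulmxA ins_boundary mulmxBr mulmx1 mulmxA delins.
by rewrite /collapse subKr mulmxBr opprD addrA subrK.
Qed.

Lemma simplex_collapse S : exists2 c,
  simplex S *m collapse =
    (if w \in S then c else 1) *: simplex (if w \in S then v |: (S :\ w) else S) &
  v \in S -> c = 0.
Proof.
exists (if v \in S then 0 else sgn w S * sgn v (S :\ w)); last by move=> ->.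
rewrite /collapse mulmxBr mulmx1 mulmxA simplex_del -scalemxAl mulmxBr.
rewrite !simplex_ins !inE eqxx vw /=; case: ifP => wS; last by rewrite scale0r subr0 scale1r.
rewrite setD1K // scalerBr !scalerA sgn_setD1 // ltnn mul1r sgnK scale1r opprB addrC subrK.
by case: ifP; rewrite ?mulr0.
Qed.

Lemma simplex_prism S : exists2 c, simplex S *m prism = c *: simplex (v |: S) &
  ((w \notin S) || (v \in S)) -> c = 0.
Proof.
rewrite /prism !mulmxA simplex_del -!scalemxAl.
rewrite simplex_ins -scalemxAl simplex_ins !inE eqxx /= !scalerA.
case: (boolP (w \in S)) => wS /=; last first.
  by exists 0 => //; rewrite !mul0r !scale0r.
rewrite setD1K // (negPf vw) /=; eexists; first by [].
by move=> ->; rewrite mulr0.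
Qed.

Lemma simplex_nonempty S (P := [pred T : {set V} | T != set0]) :
  simplex S *m chains P = (if S == set0 then 0 else 1) *: simplex S.
Proof. by rewrite simplex_chains /=; case: eqP. Qed.

Lemma collapse_boundary1 : collapse *m boundary = boundary *m collapse.
Proof.
rewrite /boundary mulmxA collapse_boundary -!mulmxA; congr (_ *m _).
apply: simplex_ext => S; rewrite !mulmxA simplex_nonempty -scalemxAl.
have [c -> c0] := simplex_collapse S.
rewrite -scalemxAl simplex_nonempty !scalerA; congr (_ *: _); rewrite mulrC.
case: (boolP (w \in S)) => // wS.
have -> : (v |: S :\ w == set0) = false by apply/set0Pn; exists v; rewrite !inE eqxx.
by have -> : (S == set0) = false by apply/set0Pn; exists w.
Qed.

(** The prism neither sees nor produces the empty simplex, so the augmented formula descends by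
    projecting on the right. *)
Lemma prism_boundary1 (P := [pred T : {set V} | T != set0]) :
  prism *m boundary + boundary *m prism = chains P - collapse *m chains P.
Proof.
have pP : prism *m chains P = prism.
  apply: simplex_ext => S; rewrite mulmxA; have [c -> _] := simplex_prism S.
  rewrite -scalemxAl simplex_nonempty.
  have -> : (v |: S == set0) = false by apply/set0Pn; exists v; rewrite !inE eqxx.
  by rewrite scale1r.
have Pp : chains P *m prism = prism.
  apply: simplex_ext => S; rewrite mulmxA simplex_nonempty.
  case: eqP => [->|_]; rewrite ?scale1r // scale0r mul0mx.
  by have [c -> ->] := simplex_prism set0; rewrite ?scale0r // inE.
move: prism pP Pp prism_boundary => h hP Ph hb.
rewrite /boundary -[_ *m chains _ *m h]mulmxA Ph -[in X in _ + X]hP !mulmxA.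
by rewrite -mulmxDl hb mulmxBl mul1mx.
Qed.

End Collapse.

Definition cycles_of (K : pred {set V}) j : 'M[F]_(dim V) :=
  (chains (fun S => K S && (#|S| == j.+1)) :&: kermx boundary)%MS.

Definition bounds_of (K : pred {set V}) j : 'M[F]_(dim V) :=
  chains (fun S => K S && (#|S| == j.+2)) *m boundary.

(** For [K] contained in [K'], the rank of the map induced on [j]-th homology. *)
Definition betti_of (K K' : pred {set V}) j : nat :=
  (\rank (cycles_of K j) - \rank (cycles_of K j :&: bounds_of K' j))%N.

Lemma eq_betti_of (K1 K2 K1' K2' : pred {set V}) j : K1 =1 K2 -> K1' =1 K2' ->
  betti_of K1 K1' j = betti_of K2 K2' j.
Proof.
move=> E E'; rewrite /betti_of /cycles_of /bounds_of.
rewrite (eq_chains (P := fun S => K1 S && (#|S| == j.+1))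
  (Q := fun S => K2 S && (#|S| == j.+1))) => [|S]; last by rewrite E.
rewrite (eq_chains (P := fun S => K1' S && (#|S| == j.+2))
  (Q := fun S => K2' S && (#|S| == j.+2))) // => S; by rewrite E'.
Qed.

Lemma cycles_ofP (K : pred {set V}) j (u : 'rV_(dim V)) :
  reflect ((u <= chains (fun S => K S && (#|S| == j.+1)))%MS /\ u *m boundary = 0)
    (u <= cycles_of K j)%MS.
Proof.
rewrite /cycles_of sub_capmx.
by apply: (iffP andP) => -[? /sub_kermxP].
Qed.

Lemma bounds_ofP (K : pred {set V}) j (u : 'rV_(dim V)) :
  (u <= bounds_of K j)%MS ->
  exists2 x : 'rV_(dim V), (x <= chains (fun S => K S && (#|S| == j.+2)))%MS &
    u = x *m boundary.
Proof.
case/submxP => D ->; exists (D *m chains (fun S => K S && (#|S| == j.+2))).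
  exact: submxMl.
by rewrite /bounds_of mulmxA.
Qed.

Lemma bounds_of_mem (K : pred {set V}) j (x : 'rV_(dim V)) :
  (x <= chains (fun S => K S && (#|S| == j.+2)))%MS -> (x *m boundary <= bounds_of K j)%MS.
Proof. exact: submxMr. Qed.

Lemma cycles_of_sub (K K' : pred {set V}) j :
  (forall S, #|S| == j.+1 -> K S -> K' S) -> (cycles_of K j <= cycles_of K' j)%MS.
Proof.
move=> KK; apply: capmxS => //; apply: chains_sub => S /andP[KS cS].
by rewrite cS KK.
Qed.

Lemma bounds_of_sub (K K' : pred {set V}) j :
  (forall S, #|S| == j.+2 -> K S -> K' S) -> (bounds_of K j <= bounds_of K' j)%MS.
Proof.
move=> KK; apply: submxMr; apply: chains_sub => S /andP[KS cS].
by rewrite cS KK.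
Qed.

(** The collapse and the inclusion back give the two inequalities; each is injective on the relevant
    quotient. *)
Lemma betti_of_collapse (v w : V) (K K' : pred {set V}) j : v != w ->
  (forall S, K S -> K' S) ->
  (forall S, w \in S -> K S -> K (v |: S)) ->
  (forall S, w \in S -> K S -> K (v |: (S :\ w))) ->
  (forall S, w \in S -> K' S -> K' (v |: (S :\ w))) ->
  betti_of K K' j = betti_of (fun S => K S && (w \notin S))
    (fun S => K' S && (w \notin S)) j.
Proof.
move=> vw KK' Kv Kvw K'vw.
have collapse_chains (L : pred {set V}) i :
    (forall S, w \in S -> L S -> L (v |: (S :\ w))) ->
    (chains (fun S => L S && (#|S| == i)) *m collapse v w <=
      chains (fun S => (L S && (w \notin S)) && (#|S| == i)))%MS.
  move=> Lvw; apply: chains_mulP => S /andP[LS cS].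
  have [c -> c0] := simplex_collapse vw S.
  case: (boolP (w \in S)) => wS; last first.
    by rewrite scale1r; apply: simplex_in; rewrite LS wS.
  case: (boolP (v \in S)) => vS; first by rewrite c0 // scale0r sub0mx.
  apply/scalemx_sub/simplex_in; rewrite Lvw // !inE eqxx eq_sym (negPf vw) /=.
  by rewrite cardsU1 !inE (negPf vS) andbF add1n -(eqP cS) [in X in _ == X](cardsD1 w) wS.
have collapse_id (L : pred {set V}) i (u : 'rV_(dim V)) :
    (u <= chains (fun S => (L S && (w \notin S)) && (#|S| == i)))%MS ->
    u *m collapse v w = u.
  move=> /chains_id <-; rewrite -mulmxA; congr (_ *m _); apply: simplex_ext => S.
  rewrite mulmxA simplex_chains -scalemxAl.
  have [c -> _] := simplex_collapse vw S.
  by case: (w \in S); rewrite ?scale1r // andbF !scale0r.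
have sub_chains (L : pred {set V}) i :
    (chains (fun S => (L S && (w \notin S)) && (#|S| == i)) <=
      chains (fun S => L S && (#|S| == i)))%MS.
  by apply: chains_sub => S /andP[/andP[-> _]].
apply/eqP; rewrite eqn_leq; apply/andP; split.
  apply: (rank_quo_leq (I := collapse v w)).
    apply/row_subP => i; rewrite row_mul.
    have /cycles_ofP[uK ud] := row_sub i (cycles_of K j).
    apply/cycles_ofP; split; first exact: submx_trans (submxMr _ uK) (collapse_chains _ _ Kvw).
    by rewrite -mulmxA collapse_boundary1 // mulmxA ud mul0mx.
  move=> u /cycles_ofP[uK ud] /bounds_ofP[x xK' ux].
  (* Simplices with [j.+1] vertices are nonempty, so the projector in the homotopy formula fixes
     these chains. *)
  have unz : u *m chains [pred T : {set V} | T != set0] = u.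
    apply: chains_id; apply: submx_trans uK _; apply: chains_sub => S /andP[_ /eqP cS] /=.
    by rewrite -card_gt0 cS.
  have ucnz : u *m collapse v w *m chains [pred T : {set V} | T != set0] = u *m collapse v w.
    apply: chains_id; apply: submx_trans (submxMr _ uK) _.
    apply: submx_trans (collapse_chains _ _ Kvw) _; apply: chains_sub => S /andP[_ /eqP cS] /=.
    by rewrite -card_gt0 cS.
  (* The cycle [u] is its collapse plus the boundary of its prism, and both terms bound in [K']. *)
  have := congr1 (mulmx u) (prism_boundary1 vw).
  rewrite mulmxDr mulmxBr (mulmxA u boundary) ud mul0mx addr0.
  rewrite (mulmxA u (collapse v w)) (mulmxA u (prism v w)) unz ucnz => /eqP.
  rewrite eq_sym subr_eq => /eqP ->; apply: addmx_sub; last first.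
    rewrite ux; apply: submx_trans (bounds_of_mem xK') _.
    by apply: bounds_of_sub => S _ /andP[].
  apply: bounds_of_mem; apply: chains_mul_sub uK => S /andP[KS cS].
  have [c -> c0] := simplex_prism vw S.
  case: (boolP (w \in S)) c0 => [wS|_] c0; last by rewrite c0 // scale0r sub0mx.
  case: (boolP (v \in S)) c0 => [vS|vS] c0; first by rewrite c0 // scale0r sub0mx.
  by apply/scalemx_sub/simplex_in; rewrite cardsU1 vS (eqP cS) KK' ?Kv /=.
(* Conversely, a cycle avoiding [w] is fixed by the collapse, so collapsing a chain that it bounds
   yields one avoiding [w]. *)
apply: (rank_quo_leq (I := 1%:M)).
  by rewrite mulmx1; apply: cycles_of_sub => S _ /andP[].
move=> u /cycles_ofP[uK ud]; rewrite mulmx1 => /bounds_ofP[x xK' ux].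
rewrite -(collapse_id _ _ _ uK) ux -mulmxA -collapse_boundary1 // mulmxA.
apply: bounds_of_mem; exact: submx_trans (submxMr _ xK') (collapse_chains _ _ K'vw).
Qed.

End Operators.

(** * Relabelling and retraction of vertex sets *)

Section Relabel.
Variables (X V : finType) (rkX : X -> nat) (rk : V -> nat) (f : X -> V).
Hypothesis f_inj : injective f.
Hypothesis f_rk : forall x y, (rk (f x) < rk (f y))%N = (rkX x < rkX y)%N.
Implicit Types (S : {set X}) (T : {set V}).

(** Since [f] preserves the vertex order, no signs occur. The matrix [J] inverts [I] on simplices
    inside the image of [f] and kills the others. *)
Let I : 'M[F]_(dim X, dim V) := monomial (fun=> 1) (fun S => f @: S).
Let J : 'M[F]_(dim V, dim X) :=
  monomial (fun T => (T \subset f @: setT)%:R) (fun T => f @^-1: T).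

Lemma simplex_relabel S : simplex S *m I = simplex (f @: S).
Proof. by rewrite simplex_monomial scale1r. Qed.

Lemma simplex_unlabel T :
  simplex T *m J = (T \subset f @: setT)%:R *: simplex (f @^-1: T).
Proof. exact: simplex_monomial. Qed.

Lemma preim_imset S : f @^-1: (f @: S) = S.
Proof. by apply/setP => x; rewrite inE mem_imset. Qed.

Lemma imset_preim T : T \subset f @: setT -> f @: (f @^-1: T) = T.
Proof.
move=> /subsetP TX; apply/setP => v; apply/imsetP/idP => [[x + ->]|vT].
  by rewrite inE.
by have /imsetP[x _ vx] := TX v vT; exists x; rewrite // inE -vx.
Qed.

Lemma relabelK : I *m J = 1%:M.
Proof.
apply: simplex_ext => S; rewrite mulmxA simplex_relabel simplex_unlabel mulmx1.
by rewrite imsetS ?subsetT // scale1r preim_imset.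
Qed.

(** Contractions by vertices outside the image of [f] vanish on relabelled simplices; the others
    correspond one to one, with equal signs. *)
Lemma relabel_boundary : boundary rkX *m I = I *m boundary rk.
Proof.
have delE x : del rkX x *m I = I *m del rk (f x).
  apply: simplex_ext => S; rewrite !mulmxA simplex_relabel !simplex_del -scalemxAl.
  have fD : f @: (S :\ x) = f @: S :\ f x.
    apply/setP => v; rewrite !inE; apply/imsetP/andP => [[y + ->]|[vx /imsetP[y yS vy]]].
      by rewrite !inE inj_eq // => /andP[-> yS]; rewrite imset_f.
    by exists y; rewrite // !inE yS andbT; apply: contraNneq vx => <-; rewrite vy.
  suff sgnE : sgn rkX x S = sgn rk (f x) (f @: S).
    by rewrite simplex_relabel mem_imset // fD sgnE.
  rewrite /sgn; congr (_ ^+ _); rewrite -(card_imset _ f_inj); apply: eq_card => v.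
  rewrite !inE; apply/imsetP/andP => [[y + ->]|[/imsetP[y yS ->] yx]].
    by rewrite inE f_rk => /andP[yS ->]; rewrite imset_f.
  by exists y; rewrite // inE yS -f_rk.
have nz : chains [pred S : {set X} | S != set0] *m I =
    I *m chains [pred T : {set V} | T != set0].
  apply: simplex_ext => S; rewrite !mulmxA simplex_relabel !simplex_chains -scalemxAl.
  by rewrite simplex_relabel /= imset_eq0.
rewrite /boundary -mulmxA nz !mulmxA; congr (_ *m _).
rewrite /full_boundary mulmx_sumr mulmx_suml (bigID (mem (codom f))) /=.
rewrite [X in _ = _ + X]big1 ?addr0 => [|v vf].
  rewrite (eq_bigl (mem [set f x | x in X])) => [|v]; last first.
    by apply/codomP/imsetP => [[x ->]|[x _ ->]]; exists x.
  by rewrite big_imset /=; [apply: eq_bigr | move=> x y _ _; apply: f_inj].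
apply: simplex_ext => S; rewrite mulmxA simplex_relabel simplex_del mulmx0.
case: ifP => [/imsetP[x _ vx]|_]; last by rewrite scale0r.
by rewrite vx codom_f in vf.
Qed.

Lemma betti_of_relabel (K K' : pred {set V}) j :
  betti_of rkX (fun S => K (f @: S)) (fun S => K' (f @: S)) j =
  betti_of rk (fun T => K T && (T \subset f @: setT))
    (fun T => K' T && (T \subset f @: setT)) j.
Proof.
have IK (L : pred {set V}) i : (chains (fun S => L (f @: S) && (#|S| == i)) *m I <=
    chains (fun T => (L T && (T \subset f @: setT)) && (#|T| == i)))%MS.
  apply: chains_mulP => S /andP[LS cS]; rewrite simplex_relabel.
  by apply: simplex_in; rewrite LS card_imset // cS imsetS ?subsetT.
have JK (L : pred {set V}) i :
    (chains (fun T => (L T && (T \subset f @: setT)) && (#|T| == i)) *m J <=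
    chains (fun S => L (f @: S) && (#|S| == i)))%MS.
  apply: chains_mulP => T /andP[/andP[LT TX] cT]; rewrite simplex_unlabel TX scale1r.
  by apply: simplex_in; rewrite imset_preim // LT -(card_imset _ f_inj) imset_preim.
have JI (L : pred {set V}) i (u : 'rV_(dim V)) :
    (u <= chains (fun T => (L T && (T \subset f @: setT)) && (#|T| == i)))%MS ->
    u *m J *m I = u.
  move=> /chains_id <-; rewrite -!mulmxA; congr (_ *m _); apply: simplex_ext => T.
  rewrite !mulmxA simplex_chains -!scalemxAl simplex_unlabel -scalemxAl simplex_relabel.
  case: (boolP (T \subset _)) => TX; last by rewrite andbF !scale0r.
  by rewrite scale1r imset_preim.
(* The boundary is transported along [I] only, so identities on the [X] side are checked after
   applying [I]. *)
have cancelI n (A B : 'M_(n, dim X)) : A *m I = B *m I -> A = B.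
  by move=> /(congr1 (mulmx^~ J)); rewrite -!mulmxA relabelK !mulmx1.
apply/eqP; rewrite eqn_leq; apply/andP; split.
  apply: (rank_quo_leq (I := I)).
    apply/row_subP => i; rewrite row_mul.
    have /cycles_ofP[uK ud] := row_sub i (cycles_of rkX (fun S => K (f @: S)) j).
    apply/cycles_ofP; split; first exact: submx_trans (submxMr _ uK) (IK _ _).
    by rewrite -mulmxA -relabel_boundary mulmxA ud mul0mx.
  move=> u _ /bounds_ofP[x xK' ux].
  have -> : u = x *m J *m boundary rkX.
    by apply: cancelI; rewrite ux -[in RHS]mulmxA relabel_boundary mulmxA (JI _ _ _ xK').
  apply: bounds_of_mem; exact: submx_trans (submxMr _ xK') (JK _ _).
apply: (rank_quo_leq (I := J)).
  apply/row_subP => i; rewrite row_mul.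
  have /cycles_ofP[uK ud] := row_sub i
    (cycles_of rk (fun T => K T && (T \subset f @: setT)) j).
  apply/cycles_ofP; split; first exact: submx_trans (submxMr _ uK) (JK _ _).
  by apply: cancelI; rewrite mul0mx -mulmxA relabel_boundary mulmxA (JI _ _ _ uK).
move=> u /cycles_ofP[uK _] /bounds_ofP[x xK' ux].
rewrite -(JI _ _ _ uK) ux -mulmxA relabel_boundary mulmxA.
apply: bounds_of_mem; exact: submx_trans (submxMr _ xK') (IK _ _).
Qed.

(* The vertices outside the image of [f] are collapsed one at a time, each [w]
   onto [f (p w)]. *)
Lemma betti_of_retract (rk_inj : injective rk) (p : V -> X) (L L' : pred {set X}) j :
  cancel f p -> (forall S, L S -> L' S) ->
  betti_of rkX L L' j =
  betti_of rk (fun T => L (p @: T)) (fun T => L' (p @: T)) j.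
Proof.
move=> fp LL.
have pf S : p @: (f @: S) = S by rewrite -imset_comp (eq_imset (g := id)) ?imset_id.
have E (M : pred {set X}) : M =1 (fun S => M (p @: (f @: S))) by move=> S; rewrite pf.
rewrite (eq_betti_of rkX j (E L) (E L')).
rewrite (betti_of_relabel (fun T => L (p @: T)) (fun T => L' (p @: T))).
(* The list [ws] holds the vertices already collapsed; when it holds all vertices outside the image
   of [f], what remains is the relabelled complex. *)
pose avoid (ws : seq V) (M : pred {set X}) (T : {set V}) :=
  M (p @: T) && all (fun w => w \notin T) ws.
suff step ws : all (fun w => w \notin codom f) ws ->
    betti_of rk (avoid [::] L) (avoid [::] L') j = betti_of rk (avoid ws L) (avoid ws L') j.
  have A0 (M : pred {set X}) : avoid [::] M =1 (fun T => M (p @: T)).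
    by move=> T; rewrite /avoid /= andbT.
  rewrite -(eq_betti_of rk j (A0 L) (A0 L')).
  rewrite (step [seq w <- enum V | w \notin codom f]) ?filter_all //.
  have A1 (M : pred {set X}) : (fun T => M (p @: T) && (T \subset f @: setT)) =1
      avoid [seq w <- enum V | w \notin codom f] M.
    move=> T; rewrite /avoid; congr (_ && _); apply/subsetP/allP => [H w|H w wT].
      rewrite mem_filter => /andP[wf _]; apply: contra wf => /H /imsetP[x _ ->].
      exact: codom_f.
    have := H w; rewrite mem_filter mem_enum andbT wT.
    case: (boolP (w \in codom f)) => [/codomP[x ->] _|_ /(_ isT)//].
    by rewrite imset_f.
  exact: eq_betti_of.
elim: ws => //= w ws IH /andP[wf wsf]; rewrite IH //.
have vf : f (p w) \in codom f by apply: codom_f.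
have vw : f (p w) != w by apply: contraNneq wf => <-.
have vws : {in ws, forall x, x != f (p w)}.
  by move=> x /(allP wsf); apply: contraNneq => ->.
(* The vertices [w] and [f (p w)] have the same image under [p], so neither move of the collapse
   changes the image of a simplex. *)
have pU (T : {set V}) : w \in T -> p @: (f (p w) |: T) = p @: T.
  by move=> wT; rewrite imsetU1 fp; apply/setUidPr; rewrite sub1set imset_f.
have pD (T : {set V}) : w \in T -> p @: (f (p w) |: (T :\ w)) = p @: T.
  by move=> wT; rewrite imsetU1 fp -imsetU1 setD1K.
rewrite (betti_of_collapse rk_inj j vw).
- by apply: eq_betti_of => T; rewrite /avoid /= andbAC -andbA.
- by move=> T /andP[/LL h1 h2]; rewrite /avoid h1.
- move=> T wT /andP[LT aT]; rewrite /avoid pU // LT; apply/allP => x xws.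
  by rewrite !inE negb_or vws // (allP aT).
- move=> T wT /andP[LT aT]; rewrite /avoid pD // LT; apply/allP => x xws.
  by rewrite !inE !negb_or vws // negb_and (allP aT) // orbT.
- move=> T wT /andP[LT aT]; rewrite /avoid pD // LT; apply/allP => x xws.
  by rewrite !inE !negb_or vws // negb_and (allP aT) // orbT.
Qed.

End Relabel.
End Chains.
(** * Bottleneck matchings *)

Section BottleneckBound.
Variable R : realFieldType.
Implicit Types (P Q : seq (R * R)) (p q : R * R) (e : R).

Lemma bneck_eq_le e Q Q' (J : seq ((R * R) * (R * R))) : 0 <= e ->
  perm_eq Q (unzip1 J) -> perm_eq Q' (unzip2 J) ->
  all (fun i => bcost i.1 i.2 <= e) J -> bneck_eq Q Q' <= e.
Proof.
move=> e0 QJ Q'J Je; have [J' J'J J'Q] := perm_unzip QJ.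
have Q'J' : perm_eq (unzip2 J') Q'.
  by rewrite perm_sym (perm_trans Q'J) // perm_sym perm_map.
have sQ' : size Q' == size Q.
  by rewrite -(perm_size Q'J') -J'Q !size_map.
(* Once the left components are in the order of [Q], the right ones are a rearrangement of [Q'],
   which is the wanted permutation. *)
have /tuple_permP[s sE] : perm_eq (unzip2 J') (Tuple sQ') by [].
apply: le_trans (bigmin_le _ s _) _; rewrite /perm_cost.
apply: bigmax_le => // i _.
have iJ' : (i < size J')%N.
  by have := ltn_ord i; rewrite -[X in (_ < X)%N -> _](congr1 size J'Q) size_map.
have -> : nth (0, 0) Q' (s i) = nth (0, 0) (unzip2 J') i.
  by rewrite sE (nth_map i) ?size_enum_ord // nth_ord_enum (tnth_nth (0, 0)).
have nthQ (m : nat) : nth (0, 0) Q m = nth (0, 0) (unzip1 J') m by rewrite J'Q.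
rewrite nthQ (nth_map ((0, 0), (0, 0))) // (nth_map ((0, 0), (0, 0))) //.
move: Je; rewrite -(perm_all _ J'J) => /allP; apply; exact: mem_nth.
Qed.

Definition proper_bar p : bool := p.1 < p.2.
Definition short e p : bool := `|p.2 - p.1| <= e + e.

Lemma near_bcost e p q : near e p q -> bcost p q <= e.
Proof. by rewrite /near /bcost ge_min ge_max => ->. Qed.

(** The second branch of [bcost] ignores positions, so leftover short bars may be paired
    arbitrarily, also with diagonal points. *)
Lemma short_bcost e p q : short e p -> short e q -> bcost p q <= e.
Proof.
rewrite /short /bcost ge_min => hp hq; apply/orP; right.
by rewrite ler_pdivrMr ?ltr0n // mulr_natr mulr2n ge_max hp.
Qed.

Lemma near_short e p q : near e p q -> proper_bar p -> ~~ proper_bar q -> short e p.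
Proof.
rewrite /near /proper_bar /short -leNgt => /andP[]; rewrite !ler_norml => h1 h2 h3 h4.
apply/andP; split; lra.
Qed.

Lemma near_sym e p q : near e p q -> near e q p.
Proof. by rewrite /near !(distrC p.1) !(distrC p.2). Qed.

Lemma all_zip (T U : Type) (a : pred T) (b : pred U) s t : all a s -> all b t ->
  all (fun i => a i.1 && b i.2) (zip s t).
Proof. by elim: s t => [|x s IH] [|y t] //= /andP[-> /IH h] /andP[-> /h]. Qed.

Lemma perm_filterI (T : eqType) (a b : pred T) s :
  perm_eq (filter a s) ([seq x <- s | a x && b x] ++ [seq x <- s | a x && ~~ b x]).
Proof.
rewrite -(perm_filterC b (filter a s)) -!filter_predI.
by rewrite (eq_filter (a1 := predI b a) (a2 := fun x => a x && b x)) ?(eq_filter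
  (a1 := predI (predC b) a) (a2 := fun x => a x && ~~ b x)) // => x; rewrite /= andbC.
Qed.

(** Pairs of proper bars are kept. A proper bar whose partner is improper is short, and the two
    sides' short leftovers are paired with each other and with the padding. *)
Lemma bneck_near e P P' Q Q' : 0 <= e -> matched (near e) P P' ->
  perm_eq Q (filter proper_bar P) -> perm_eq Q' (filter proper_bar P') ->
  (size Q' <= size Q)%N ->
  bneck_eq Q (Q' ++ nseq (size Q - size Q') (0, 0)) <= e.
Proof.
move=> e0 [I [PI PI' Ie]] QP QP' sQ.
pose a (i : (R * R) * (R * R)) := proper_bar i.1.
pose b (i : (R * R) * (R * R)) := proper_bar i.2.
pose B := [seq i <- I | a i && b i].
pose D1 := [seq i.1 | i <- I & a i && ~~ b i].
pose D2 := [seq i.2 | i <- I & b i && ~~ a i].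
have QE : perm_eq Q (unzip1 B ++ D1).
  rewrite (perm_trans QP) // (perm_trans (perm_filter _ PI)) // /unzip1 filter_map.
  by rewrite -map_cat; apply: perm_map; apply: perm_filterI.
have QE' : perm_eq Q' (unzip2 B ++ D2).
  rewrite (perm_trans QP') // (perm_trans (perm_filter _ PI')) // /unzip2 filter_map.
  rewrite -map_cat; apply: perm_map.
  rewrite /B (eq_filter (a1 := fun i => a i && b i) (a2 := fun i => b i && a i)).
    exact: perm_filterI.
  by move=> i; rewrite /= andbC.
(* The kept pairs count equally on both sides, so the padding is exactly what the leftovers lack. *)
have sD : (size Q - size Q' = size D1 - size D2)%N.
  by rewrite (perm_size QE) (perm_size QE') !size_cat !size_map subnDl.
have sD12 : (size D2 <= size D1)%N.
  by move: sQ; rewrite (perm_size QE) (perm_size QE') !size_cat !size_map leq_add2l.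
pose D2' := D2 ++ nseq (size Q - size Q') (0, 0).
have sD2' : size D1 = size D2' by rewrite size_cat size_nseq sD subnKC.
apply: (@bneck_eq_le _ _ _ (B ++ zip D1 D2')) => //.
- by rewrite /unzip1 map_cat -/(unzip1 (zip _ _)) unzip1_zip // sD2'.
- rewrite /unzip2 map_cat -/(unzip2 (zip _ _)) unzip2_zip ?sD2' // /D2' catA.
  by rewrite perm_cat2r.
rewrite all_cat; apply/andP; split.
  apply/allP => i; rewrite mem_filter => /andP[_ iI]; apply: near_bcost.
  exact: (allP Ie).
have S1 : all (short e) D1.
  apply/allP => _ /mapP[i + ->]; rewrite mem_filter => /andP[/andP[ai bi] iI].
  by apply: near_short ai bi; apply: (allP Ie).
have S2 : all (short e) D2'.
  rewrite all_cat; apply/andP; split; last first.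
    by rewrite all_nseq /short /= subrr normr0 addr_ge0 ?orbT.
  apply/allP => _ /mapP[i + ->]; rewrite mem_filter => /andP[/andP[bi ai] iI].
  by apply: near_short bi ai; apply/near_sym/(allP Ie).
by apply: sub_all (all_zip S1 S2) => i /andP[]; apply: short_bcost.
Qed.

Lemma bottleneck_near e P P' Q Q' : 0 <= e -> matched (near e) P P' ->
  perm_eq Q (filter proper_bar P) -> perm_eq Q' (filter proper_bar P') ->
  bottleneck Q Q' <= e.
Proof.
move=> e0 PP QP QP'; rewrite /bottleneck; case: leqP => sQ.
  exact: bneck_near PP QP QP' sQ.
have P'P : matched (near e) P' P.
  case: PP => I [h1 h2 h3]; exists [seq (i.2, i.1) | i <- I].
  rewrite /unzip1 /unzip2 -!map_comp; split=> //.
  by rewrite all_map; apply: sub_all h3 => i /near_sym.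
exact: bneck_near P'P QP' QP (ltnW sQ).
Qed.

End BottleneckBound.

(** * Networks and their diagrams *)

Definition vertex_rank (X : finType) (x : X) : nat := enum_rank x.

Section Networks.
Variables (R : realFieldType) (F : fieldType).

Section OneNetwork.
Variables (X : finType) (K : nat) (r : network R X).
Hypothesis rP : is_dissim_network K r.

Lemma fvals_mem k (t : k.+1.-tuple X) : (k <= K)%N -> r t \in fvals K r.
Proof.
move=> kK; apply/flattenP; exists [seq r t | t : k.+1.-tuple X].
  by apply/mapP; exists k => //; rewrite mem_iota ltnS.
exact: image_f.
Qed.

Lemma fvals_bound v : v \in fvals K r -> 0 <= v <= 1.
Proof.
case/flattenP => _ /mapP[k + ->] /imageP[t _ ->].
by rewrite mem_iota ltnS /= => kK; apply: (proj1 rP).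
Qed.

Lemma inLP a S : reflect (exists k (t : k.+1.-tuple X),
  [/\ (k <= K)%N, [set x in t] = S & r t <= a]) (inL K r a S).
Proof.
apply: (iffP existsP) => [[k /existsP[t /andP[/eqP tS ta]]]|[k [t [kK tS ta]]]].
  by exists k, t; rewrite -ltnS.
have kK' : (k < K.+1)%N by [].
by exists (Ordinal kK'); apply/existsP; exists t; rewrite tS eqxx.
Qed.

Lemma inL_mono a b S : a <= b -> inL K r a S -> inL K r b S.
Proof.
move=> ab /inLP[k [t [kK tS ta]]]; apply/inLP; exists k, t; split=> //.
exact: le_trans ab.
Qed.

Lemma inL_step a b S : a <= b -> {in fvals K r, forall v, v <= b -> v <= a} ->
  inL K r a S = inL K r b S.
Proof.
move=> ab h; apply/idP/idP; first exact: inL_mono.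
case/inLP=> k [t [kK tS tb]]; apply/inLP; exists k, t; split=> //.
by apply: h tb; apply: fvals_mem.
Qed.

Lemma inL_bot S : inL K r (-1) S = false.
Proof.
apply/inLP => -[k [t [kK _]]].
by have /andP[h _] := proj1 rP k t kK; rewrite leNgt (lt_le_trans _ h) ?ltrN10.
Qed.

(** Appending a vertex already present keeps the vertex set and, by the equality clause of a
    dissimilarity network, the value. *)
Lemma network_pad k l (t : k.+1.-tuple X) : (k <= l)%N -> (l <= K)%N ->
  exists t' : l.+1.-tuple X, [set x in t'] = [set x in t] /\ r t' = r t.
Proof.
elim: l => [|l IH]; first by rewrite leqn0 => /eqP k0 _; subst k; exists t.
rewrite leq_eqVlt => /predU1P[kl _|kl lK]; first by subst k; exists t.
have [t' [t't rt']] := IH kl (ltnW lK).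
have xt' := mem_tnth ord0 t'; move: (tnth t' ord0) xt' => x xt'.
exists [tuple of rcons t' x]; split.
  by rewrite -t't; apply/setP => y; rewrite !inE mem_rcons inE; case: eqVneq => [->|].
by rewrite -rt'; apply/(proj2 (proj2 (proj2 rP) l t' x lK)).
Qed.

Lemma network_eq k l (t : k.+1.-tuple X) (t' : l.+1.-tuple X) :
  (k <= K)%N -> (l <= K)%N -> [set x in t] = [set x in t'] -> r t = r t'.
Proof.
wlog kl : k l t t' / (k <= l)%N => [H|] kK lK tt'.
  by case/orP: (leq_total k l) => h; [|apply/esym]; apply: H.
have [s [st <-]] := network_pad t kl lK.
by apply: (proj1 (proj2 rP)); rewrite // st.
Qed.

(** At most one vertex [v] of [s] satisfies [s :\ v = t], so a single contraction contributes to
    each entry. *)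
Lemma bdryE : bdry F X = boundary F (@vertex_rank X).
Proof.
apply/matrixP => i j; rewrite /boundary /chains mul_mx_diag !mxE summxE /=.
set s := enum_val i; set t := enum_val j.
have termE v : del F (@vertex_rank X) v i j =
    (if v \in s then sgn F (@vertex_rank X) v s else 0) *+ (s :\ v == t).
  by rewrite mxE.
case: ifP => [/and3P[ts t0 /cards1P[v sv]]|h].
  have /setDP[vs _] : v \in s :\: t by rewrite sv set11.
  rewrite t0 mulr1 [in LHS]sv big_set1 (bigD1 v) // termE vs big1 ?addr0 => [|u uv].
    have -> : s :\ v == t.
      by rewrite -sv setDDr setDv set0U; apply/eqP/setIidPr.
    by rewrite mulr1n /= addr0.
  rewrite termE; case: eqP => // sut; case: ifP => // us.
  have : u \in s :\: t by rewrite -sut !inE eqxx us.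
  by rewrite sv inE (negPf uv).
case: (boolP (t == set0)) h => [_ _|t0 h]; first by rewrite mulr0.
rewrite mulr1 big1 // => v _; rewrite termE; case: ifP => vs; last by rewrite mul0rn.
case: eqP => // svt; case/negP: (negbT h).
apply/and3P; split=> //; first by rewrite -svt subD1set.
by rewrite -svt setDDr setDv set0U (setIidPr _) ?cards1 // sub1set.
Qed.

Lemma pbettiE j s t : pbetti F K r j s t =
  betti_of F (@vertex_rank X) (inL K r s) (inL K r t) j.
Proof. by rewrite /pbetti /betti_of /cycles /bounds bdryE. Qed.

End OneNetwork.
End Networks.
(** Each [z] is the dimension of an intersection, each [x] the matching persistent Betti number, and
    [n], [n'] are the ranks of the two cycle spaces, which cancel. *)
Lemma incl_excl_sub (c z1 z2 z3 z4 x1 x2 x3 x4 n n' : nat) :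
  (c + z1 + z2 = z3 + z4 -> x2 + z2 = n -> x4 + z4 = n' -> x1 + z1 = n' ->
   x3 + z3 = n -> c = x2 + x1 - (x4 + x3))%N.
Proof. lia. Qed.

(** * Persistence diagrams as points of a pair of flags *)

Section Diagrams.
Variables (R : realFieldType) (F : fieldType).

(* Every class is declared dead at parameter [1], and the flags become full, so
   that points born at [1] or later lie below the diagonal. *)
Definition truncate n (M : R -> 'M[F]_n) (s : R) : 'M[F]_n :=
  if s < 1 then M s else 1%:M.

Lemma flag_truncate n G (M : R -> 'M[F]_n) : uniq G -> {in G, forall g, -1 < g} ->
  1 \in G -> step_on G M -> (forall s t, s <= t -> (M s <= M t)%MS) -> M (-1) = 0 ->
  flag G (truncate M).
Proof.
move=> Gu G0 G1 Mst Mm M0; split=> //; rewrite /truncate.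
- move=> s t st h; case: (ltP t 1) => t1; first by rewrite (le_lt_trans st t1) (Mst s t).
  by rewrite ltNge (h 1 G1 t1).
- move=> s t st; case: (ltP t 1) => t1; last exact: submx1.
  by rewrite (le_lt_trans st t1) Mm.
- by rewrite (lt_trans (ltrN10 _) ltr01).
by move=> s; rewrite ltNge => ->.
Qed.

Lemma interleaved_truncate n (M M' : R -> 'M[F]_n) e : 0 <= e ->
  (forall s, (M s <= M' (s + e)%R)%MS /\ (M' s <= M (s + e)%R)%MS) ->
  interleaved e (truncate M) (truncate M').
Proof.
move=> e0 MM s; rewrite /truncate; case: (ltP (s + e) 1) => [se|_].
  by rewrite (le_lt_trans _ se) ?lerDl.
by rewrite !submx1.
Qed.

Section OneDiagram.
Variables (X V : finType) (K : nat) (r : network R X).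
Hypothesis rP : is_dissim_network K r.
Variables (rk : V -> nat) (f : X -> V) (p : V -> X).
Hypothesis rk_inj : injective rk.
Hypothesis fp : cancel f p.
Hypothesis f_rk : forall x y, (rk (f x) < rk (f y))%N = (vertex_rank x < vertex_rank y)%N.

Definition pullback s : pred {set V} := fun T => inL K r s (p @: T).

(** The value 1 is added because the truncated flags jump there. *)
Definition grid : seq R := undup (1 :: fvals K r).

Definition cycle_flag j := truncate (fun s => cycles_of F rk (pullback s) j).
Definition bound_flag j := truncate (fun s => bounds_of F rk (pullback s) j).

Lemma grid_bound g : g \in grid -> -1 < g <= 1.
Proof.
rewrite mem_undup inE => /predU1P[->|/(fvals_bound rP)/andP[g0 ->]].
  by rewrite lexx (lt_trans (ltrN10 _) ltr01).
by rewrite andbT (lt_le_trans _ g0) ?ltrN10.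
Qed.

Lemma pullback_step s t : s <= t -> {in grid, forall g, g <= t -> g <= s} ->
  pullback s =1 pullback t.
Proof.
move=> st h T; apply: inL_step => // v vr; apply: h.
by rewrite mem_undup inE vr orbT.
Qed.

Lemma eq_cycles_of (L L' : pred {set V}) j : L =1 L' -> cycles_of F rk L j = cycles_of F rk L' j.
Proof.
by move=> LL; congr (_ :&: _)%MS; apply: eq_chains => S; rewrite LL.
Qed.

Lemma eq_bounds_of (L L' : pred {set V}) j : L =1 L' -> bounds_of F rk L j = bounds_of F rk L' j.
Proof.
by move=> LL; congr (_ *m _); apply: eq_chains => S; rewrite LL.
Qed.

Lemma chains_pred0 (L : pred {set V}) : L =1 pred0 -> chains F L = 0.
Proof.
move=> L0; apply: simplex_ext => S.
by rewrite simplex_chains L0 scale0r mulmx0.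
Qed.

Lemma flag_cycles j : flag grid (cycle_flag j).
Proof.
apply: flag_truncate.
- exact: undup_uniq.
- by move=> g /grid_bound/andP[].
- by rewrite mem_undup mem_head.
- by move=> s t st h; apply/eq_cycles_of/pullback_step.
- by move=> s t st; apply: cycles_of_sub => S _; apply: inL_mono.
- by rewrite /cycles_of chains_pred0 ?cap0mx // => S; rewrite /pullback (inL_bot rP).
Qed.

Lemma flag_bounds j : flag grid (bound_flag j).
Proof.
apply: flag_truncate.
- exact: undup_uniq.
- by move=> g /grid_bound/andP[].
- by rewrite mem_undup mem_head.
- by move=> s t st h; apply/eq_bounds_of/pullback_step.
- by move=> s t st; apply: bounds_of_sub => S _; apply: inL_mono.
- by rewrite /bounds_of chains_pred0 ?mul0mx // => S; rewrite /pullback (inL_bot rP).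
Qed.

Lemma pbetti_pullback j s t : s <= t ->
  pbetti F K r j s t = betti_of F rk (pullback s) (pullback t) j.
Proof.
move=> st; rewrite pbettiE.
apply: (betti_of_retract F (can_inj fp) f_rk rk_inj j fp) => S.
exact: inL_mono.
Qed.

(** The added value 1 is never strictly below [b]. *)
Lemma pred_in_grid b : b <= 1 -> pred_in grid b = predv K r b.
Proof.
move=> b1; have sub (G G' : seq R) : {in G, forall v, v < b -> v \in G'} ->
    pred_in G b <= pred_in G' b.
  move=> GG; rewrite {1}/pred_in big_seq_cond.
  apply: (big_ind (fun x => x <= pred_in G' b)).
  - exact: pred_in_ge.
  - by move=> x y xb yb; rewrite ge_max xb.
  - by move=> v /andP[vG vb]; apply: le_pred_in => //; apply: GG.
apply/le_anti/andP; split; apply: sub => v; rewrite mem_undup inE.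
  by case/predU1P => [->|//]; rewrite ltNge b1.
by move=> ->; rewrite orbT.
Qed.

Lemma capdim_pbetti j s t : s <= t -> t < 1 ->
  (pbetti F K r j s t + capdim (cycle_flag j) (bound_flag j) s t =
   \rank (cycle_flag j s))%N.
Proof.
move=> st t1; rewrite pbetti_pullback // /capdim /cycle_flag /bound_flag /truncate.
by rewrite (le_lt_trans st t1) t1 /betti_of subnK // mxrankS // capmxSl.
Qed.

Lemma capdim_full j s t : 1 <= t ->
  capdim (cycle_flag j) (bound_flag j) s t = \rank (cycle_flag j s).
Proof.
by move=> t1; rewrite /capdim /bound_flag /truncate ltNge t1 /= capmx1.
Qed.

Let pts j := points grid (cycle_flag j) grid (bound_flag j).

Lemma pts_grid j : {in pts j, forall q, q.1 \in grid /\ q.2 \in grid}.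
Proof. by move=> q; apply: points_in; apply: flag_cycles. Qed.

Lemma count_pmult j (b d : R) : b \in fvals K r -> d \in grid -> b < d ->
  count_mem (b, d) (pts j) = pmult F K r j b d.
Proof.
move=> bf dG bd.
have bG : b \in grid by rewrite mem_undup inE bf orbT.
have /andP[b0 _] := grid_bound bG; have /andP[d0 d1] := grid_bound dG.
have b1 := lt_le_trans bd d1.
have G0 : {in grid, forall g, -1 < g} by move=> g /grid_bound/andP[].
have := count_mem_quadrant G0 G0 (@pts_grid j) bG dG.
rewrite -/(pts j) !(count_points (flag_cycles j) (flag_bounds j)).
rewrite /pmult -!pred_in_grid // ?(ltW b1) //.
have bd' : b <= pred_in grid d by apply: le_pred_in.
have b'b : pred_in grid b < b by apply: pred_in_lt.
have d'd : pred_in grid d < d by apply: pred_in_lt.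
have b'd' := ltW (lt_le_trans b'b bd').
have b'd := ltW (lt_trans b'b bd).
have d'1 := lt_le_trans d'd d1.
have H1 := capdim_pbetti j bd' d'1; have H2 := capdim_pbetti j b'd' d'1.
case: (ltP d 1) => d1' H.
  have H3 := capdim_pbetti j b'd d1'; have H4 := capdim_pbetti j (ltW bd) d1'.
  exact: incl_excl_sub H H1 H2 H3 H4.
(* At death 1 all cycles are counted as dead: the two Betti numbers at [d] are replaced by 0. *)
move: H; rewrite !(capdim_full j _ d1') => H.
by rewrite (incl_excl_sub H H1 H2 (add0n _) (add0n _)) !addn0.
Qed.

Lemma diagramE j : perm_eq (diagram F K r j) (filter (@proper_bar R) (pts j)).
Proof.
apply/allP => -[b d] _ /=; apply/eqP.
rewrite /diagram count_mem_nseqs; last first.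
  by rewrite filter_uniq // allpairs_uniq ?undup_uniq // => -[? ?] [? ?].
rewrite mem_filter /= count_filter.
have -> : count (predI (pred1 (b, d)) (@proper_bar R)) (pts j) =
    ((b < d)%R * count_mem (b, d) (pts j))%N.
  case: (boolP (b < d)) => bd.
    rewrite mul1n; apply: eq_count => q /=; case: eqP => // ->; exact: bd.
  rewrite mul0n (eq_count (a2 := pred0)) ?count_pred0 // => q /=.
  by case: eqP => // ->; apply: negbTE.
case: (boolP (b < d)) => bd; last by [].
rewrite mul1n andTb; case: (boolP (_ \in _)) => [/allpairsP[[b' d'] /= [bf dG [eb ed]]]|nin].
  by rewrite mem_undup in bf; subst b' d'; rewrite mul1n count_pmult.
(* The birth of a proper bar is below 1, so it is a genuine filtration value and [diagram] does list
   the pair. *)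
rewrite mul0n; apply/esym/count_memPn; apply: contra nin => /pts_grid /= [bG dG].
apply/allpairsP; exists (b, d); split=> //; rewrite mem_undup.
have /andP[_ d1] := grid_bound dG.
by move: bG; rewrite mem_undup inE (lt_eqF (lt_le_trans bd d1)).
Qed.

End OneDiagram.
End Diagrams.

(** * Correspondences and the stability bound *)

Section Correspondence.
Variables (R : realFieldType) (X Y : finType) (K : nat).
Variables (rX : network R X) (rY : network R Y).
Hypotheses (rXP : is_dissim_network K rX) (rYP : is_dissim_network K rY).

(** Values of all orders agree on equal vertex sets, so the comparison at order [k] governs every
    simplex with at most [k.+1] vertices. *)
Lemma pullback_close (V : finType) (p : V -> X) (q : V -> Y) k (e s : R) (S : {set V}) :
  (k <= K)%N ->
  (forall t : k.+1.-tuple V, rY (map_tuple q t) <= rX (map_tuple p t) + e) ->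
  (0 < #|S| <= k.+1)%N -> pullback K rX p s S -> pullback K rY q (s + e) S.
Proof.
move=> kK pq /andP[S0 Sk] /inLP[l [t [lK tS ts]]].
have /card_gt0P[v vS] := S0.
(* Repeating a vertex lists [S] as a tuple of exactly [k.+1] entries. *)
pose w := enum S ++ nseq (k.+1 - #|S|) v.
have sw : size w == k.+1 by rewrite size_cat size_nseq -cardE subnKC.
have wS : w =i S.
  move=> u; rewrite mem_cat mem_enum mem_nseq.
  by case: eqVneq => [->|]; rewrite ?vS ?andbF ?orbF.
have imw (W : finType) (h : V -> W) : [set x in map_tuple h (Tuple sw)] = h @: S.
  apply/setP => x; rewrite inE; apply/mapP/imsetP => -[u uS ->]; exists u => //.
    by rewrite -wS.
  by rewrite wS.
apply/inLP; exists k, (map_tuple q (Tuple sw)); split=> //.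
apply: le_trans (pq _) _; rewrite lerD2r.
by rewrite (network_eq rXP (t' := t)) // imw tS.
Qed.

Lemma Gamma_ge k (C : {set X * Y}) (t : k.+1.-tuple (X * Y)) :
  all (fun c => c \in C) t ->
  `|rX (map_tuple fst t) - rY (map_tuple snd t)| <= Gamma rX rY k C.
Proof.
move=> tC; exact: (le_bigmax_cond (P := fun t : k.+1.-tuple _ => all (fun c => c \in C) t)
  0 (fun t : k.+1.-tuple _ => `|rX (map_tuple fst t) - rY (map_tuple snd t)|) tC).
Qed.

(** Placing [X] before [Y] makes both injections order preserving, as relabelling requires. *)
Definition sum_rank (v : X + Y) : nat :=
  match v with inl x => enum_rank x | inr y => (#|X| + enum_rank y)%N end.

Lemma sum_rank_inj : injective sum_rank.
Proof.
have lt (x : X) (y : Y) : (enum_rank x == #|X| + enum_rank y :> nat)%N = false.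
  by rewrite ltn_eqF // ltn_addr.
move=> [x|y] [x'|y'] /= => [/val_inj/enum_rank_inj->//|/eqP|/eqP|/addnI/val_inj/enum_rank_inj->//].
  by rewrite lt.
by rewrite eq_sym lt.
Qed.

End Correspondence.

(* The disjoint union [X + Y] carries the pullbacks of both networks along the
   maps [p] and [q] chosen inside the correspondence, and retracts onto each. *)
Lemma bottleneck_corr (R : realFieldType) (F : fieldType) (X Y : finType) K
    (rX : network R X) (rY : network R Y) k k' (C : {set X * Y}) :
  is_dissim_network K rX -> is_dissim_network K rY -> (k <= K)%N -> (k' < k)%N -> is_corr C ->
  bottleneck (diagram F K rX k') (diagram F K rY k') <= Gamma rX rY k C.
Proof.
move=> rXP rYP kK k'k /andP[/forallP CX /forallP CY].
pose f x := xchoose (existsP (CX x)); pose g y := xchoose (existsP (CY y)).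
have fC x : (x, f x) \in C := xchooseP (existsP (CX x)).
have gC y : (g y, y) \in C := xchooseP (existsP (CY y)).
pose p (v : X + Y) := match v with inl x => x | inr y => g y end.
pose q (v : X + Y) := match v with inl x => f x | inr y => y end.
have pqC v : (p v, q v) \in C by case: v.
set e := Gamma rX rY k C.
have e0 : 0 <= e by apply: bigmax_ge_id.
have pq (t : k.+1.-tuple (X + Y)) :
    `|rX k (map_tuple p t) - rY k (map_tuple q t)| <= e.
  have tC : all (fun c => c \in C) (map_tuple (fun v => (p v, q v)) t).
    by rewrite all_map; apply/allP => v _; apply: pqC.
  have := Gamma_ge rX rY tC.
  have -> : map_tuple fst (map_tuple (fun v => (p v, q v)) t) = map_tuple p t.
    by apply: val_inj; rewrite /= -map_comp.
  by have -> : map_tuple snd (map_tuple (fun v => (p v, q v)) t) = map_tuple q t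
    by apply: val_inj; rewrite /= -map_comp.
have close s (S : {set X + Y}) : (0 < #|S| <= k.+1)%N ->
    (pullback K rX p s S -> pullback K rY q (s + e) S) /\
    (pullback K rY q s S -> pullback K rX p (s + e) S).
  by move=> cS; split; [apply: (pullback_close rXP kK)|apply: (pullback_close rYP kK)] => // t;
    have := pq t; rewrite ler_norml; lra.
have fp : cancel inl p by [].
have gq : cancel inr q by [].
have rkX x y : (@sum_rank X Y (inl x) < @sum_rank X Y (inl y))%N =
    (vertex_rank x < vertex_rank y)%N.
  by [].
have rkY x y : (@sum_rank X Y (inr x) < @sum_rank X Y (inr y))%N =
    (vertex_rank x < vertex_rank y)%N.
  by rewrite ltn_add2l.
have dX := diagramE F rXP (@sum_rank_inj X Y) fp rkX k'.
have dY := diagramE F rYP (@sum_rank_inj X Y) gq rkY k'.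
apply: (bottleneck_near e0 _ dX dY).
apply: points_stable.
- exact: flag_cycles.
- exact: flag_bounds.
- exact: flag_cycles.
- exact: flag_bounds.
- apply: interleaved_truncate => // s.
  by (split; apply: cycles_of_sub => S /eqP cS);
    [apply: (close s S _).1|apply: (close s S _).2]; rewrite cS /= ltnS ltnW.
(* Boundaries involve simplices with [k'.+2] vertices, within the range of order [k] precisely
   because [k' < k]. *)
- apply: interleaved_truncate => // s.
  by (split; apply: bounds_of_sub => S /eqP cS);
    [apply: (close s S _).1|apply: (close s S _).2]; rewrite cS.
Qed.

Theorem theorem2 (R : realFieldType) (F : fieldType) (X Y : finType) (K : nat)
  (rX : network R X) (rY : network R Y) :
  (1 <= K)%N -> is_dissim_network K rX -> is_dissim_network K rY ->
  forall k : nat, (1 <= k <= K)%N ->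
  forall k' : nat, (k' < k)%N ->
  ((bottleneck (diagram F K rX k') (diagram F K rY k'))%:E
     <= netdist rX rY k)%E.
Proof.
move=> _ rXP rYP k /andP[_ kK] k' k'k; rewrite /netdist.
apply: (big_ind (fun x => (_ <= x)%E)) => [|x y xb yb|C CC].
- exact: leey.
- by rewrite le_min xb.
by rewrite lee_fin; exact: (bottleneck_corr F rXP rYP kK k'k CC).
Qed.
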